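(* Let $k=k(n)$ be a sequence of positive integers with $k\to\infty$ as $n\to\infty$. If $k-\log n\to-\infty$, then with high probability $\mathcal{D}_{n,k}$ is not strongly connected. If $k-\log n\to\infty$, then with high probability $\mathcal{D}_{n,k}$ is strongly connected.
   Context: $\mathcal{D}_{n,k}$ is a uniformly random $k$-out digraph on $[n]=\{1,\dots,n\}$: each vertex has exactly $k$ out-arcs labeled $1,\dots,k$, and the endpoints of the $kn$ arcs are chosen independently and uniformly at random from $[n]$ (self-loops and multiple arcs allowed). $\log$ is the natural logarithm. ''With high probability'' means with probability tending to 1 as $n\to\infty$. *)

(* Defs.v *)
From mathcomp Require Import all_boot all_order all_algebra.
From mathcomp Require Import all_classical reals topology normedtype sequences exp.

Set Implicit Arguments.
Unset Strict Implicit.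
Unset Printing Implicit Defensive.

Import Order.TTheory GRing.Theory Num.Theory.
Import numFieldNormedType.Exports.

Local Open Scope classical_set_scope.
Local Open Scope ring_scope.

(* The vertex set [n] is represented by 'I_n and the arc labels 1, ..., k by
   'I_k; [D (u, i)] is the endpoint of the arc labeled i that leaves u.
   Self-loops and multiple arcs are allowed. *)
Definition kout_digraph (n k : nat) : finType :=
  {ffun 'I_n * 'I_k -> 'I_n}.

Definition arc (n k : nat) (D : kout_digraph n k) : rel 'I_n :=
  fun u v => [exists i : 'I_k, D (u, i) == v].

Definition strongly_connected (n k : nat) (D : kout_digraph n k) : bool :=
  [forall u : 'I_n, forall v : 'I_n, connect (arc D) u v].

(* Uniform law on a finite type.  On [kout_digraph n k] it is the law under
   which the k * n endpoints are independent and uniform on the vertex set. *)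
Definition uniform_prob (R : realType) (T : finType) (E : pred T) : R :=
  #|E|%:R / #|T|%:R.

(* [T n] is the finite sample space at stage n, under the uniform law. *)
Definition whp (R : realType) (T : nat -> finType)
    (E : forall n, pred (T n)) : Prop :=
  (fun n => uniform_prob R (E n)) @ \oo --> (1 : R).

(* Main.v *)
(* Below the threshold, the number of vertices without incoming arcs has mean
   n (1 - 1/n)^(kn) >= exp (log n - k - 1), and the events "v has no incoming
   arc" are pairwise negatively correlated, so the second moment method shows
   that such a vertex exists with high probability.

   Above the threshold, a digraph that is not strongly connected has a set S of
   s vertices, 0 < s < n, that no arc leaves; a given S has this property with
   probability (s/n)^(ks).  As C(n,s) (s/n)^s <= e^s, the s-th term of the union
   bound is at most q^min(s, n-s) with q = exp (2 - (k - log n)/2), so the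
   failure probability is at most 4q. *)
Require Import Defs.
From mathcomp Require Import all_boot all_order all_algebra.
From mathcomp Require Import all_classical reals topology normedtype sequences exp.
From mathcomp Require Import zify ring lra.

Set Implicit Arguments.
Unset Strict Implicit.
Unset Printing Implicit Defensive.

Import Order.TTheory GRing.Theory Num.Theory.
Import numFieldNormedType.Exports.

Local Open Scope classical_set_scope.
Local Open Scope ring_scope.

(** * Uniform probability on a finite type and the second moment method *)

Lemma uniform_prob_le1 (R : realType) (T : finType) (E : pred T) :
  uniform_prob R E <= 1.
Proof.
rewrite /uniform_prob; have [->|T0] := posnP #|T|.
  by rewrite invr0 mulr0.
by rewrite ler_pdivrMr ?ltr0n// mul1r ler_nat max_card.
Qed.

Lemma uniform_probE (R : realType) (T : finType) (E : pred T) :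
  uniform_prob R E = (\sum_x (E x)%:R) / #|T|%:R.
Proof.
rewrite /uniform_prob -sum1_card natr_sum big_mkcond/=; congr (_ / _).
by apply: eq_bigr => x _; rewrite unfold_in; case: (E x).
Qed.

Lemma eq_uniform_prob (R : realType) (T : finType) (E F : pred T) :
  E =1 F -> uniform_prob R E = uniform_prob R F.
Proof. by move=> EF; rewrite /uniform_prob (eq_card EF). Qed.

Lemma le_uniform_prob (R : realType) (T : finType) (E F : pred T) :
  (forall x, E x -> F x) -> uniform_prob R E <= uniform_prob R F.
Proof.
move=> EF; rewrite /uniform_prob ler_wpM2r ?invr_ge0// ler_nat.
by apply/subset_leq_card/fintype.subsetP => x; exact: EF.
Qed.

Lemma uniform_probC (R : realType) (T : finType) (E : pred T) :
  (0 < #|T|)%N ->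
  uniform_prob R (fun x => ~~ E x) = 1 - uniform_prob R E.
Proof.
move=> T0; rewrite /uniform_prob -(cardC E) natrD.
have -> : #|(fun x => ~~ E x) : pred T| = #|predC E| by exact: eq_card.
have TE : #|E|%:R + #|predC E|%:R != 0 :> R.
  by rewrite -natrD cardC pnatr_eq0 -lt0n.
by field.
Qed.

Lemma uniform_prob_union (R : realType) (T I : finType) (P : pred I)
    (E : pred T) (A : I -> pred T) :
  (forall x, E x -> exists2 i, P i & A i x) ->
  uniform_prob R E <= \sum_(i | P i) uniform_prob R (A i).
Proof.
move=> EA; under eq_bigr do rewrite uniform_probE.
rewrite uniform_probE -mulr_suml ler_wpM2r ?invr_ge0// exchange_big/=.
apply: ler_sum => x _; case: (boolP (E x)) => [/EA[i Pi Aix]|_].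
  by rewrite (bigD1 i)//= Aix lerDl sumr_ge0.
by rewrite sumr_ge0.
Qed.

(** Independence of the coordinates of a uniform function: the event is a [family], whose cardinal
    is a product. All exact probabilities below come from it. *)
Lemma uniform_prob_prod (R : realType) (I T : finType) (F : I -> {set T}) :
  uniform_prob R (fun f : {ffun I -> T} => [forall i, f i \in F i]) =
  \prod_i (#|F i|%:R / #|T|%:R).
Proof.
rewrite /uniform_prob big_split/= prodfV prodr_const -natrX -card_ffun.
congr (_ / _); rewrite -natr_prod; congr _%:R.
rewrite (eq_card (B := family F)) ?card_family ?foldrE ?big_map ?big_enum//.
Qed.

(* Chebyshev's inequality: the number of events [A v] that occur has mean
   [#|V| * p] and, by the bound on pairs, variance at most its mean. *)
Lemma second_moment_method (R : realType) (T V : finType) (A : V -> pred T)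
    (p : R) :
  (0 < #|T|)%N -> (0 < #|V|)%N -> 0 < p ->
  (forall v, uniform_prob R (A v) = p) ->
  (forall v w, v != w ->
     uniform_prob R (fun x => A v x && A w x) <= p ^+ 2) ->
  uniform_prob R (fun x => [forall v, ~~ A v x]) <= (#|V|%:R * p)^-1.
Proof.
move=> T0 V0 p0 Ap AAp; set m := #|V|%:R * p; set M : R := #|T|%:R.
have M0 : 0 < M by rewrite ltr0n.
have m0 : 0 < m by rewrite mulr_gt0// ltr0n.
pose X x : R := \sum_v (A v x)%:R.
have EX : (\sum_x X x) / M = m.
  rewrite /X exchange_big mulr_suml/=.
  under eq_bigr do rewrite -uniform_probE Ap.
  by rewrite sumr_const -mulr_natl.
(* For each [v], the diagonal pair gives [p] and the others at most [p ^+ 2] each; completing the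
   latter to all of [V] gives [p + m * p]. *)
have EX2 : (\sum_x X x ^+ 2) / M <= m + m ^+ 2.
  have -> : \sum_x X x ^+ 2 = \sum_v \sum_w \sum_x (A v x && A w x)%:R.
    under [RHS]eq_bigr do rewrite exchange_big.
    rewrite [RHS]exchange_big; apply: eq_bigr => x _ /=.
    rewrite expr2 mulr_suml; apply: eq_bigr => v _.
    by rewrite mulr_sumr; apply: eq_bigr => w _; rewrite -natrM mulnb.
  rewrite mulr_suml.
  have -> : m + m ^+ 2 = \sum_(v : V) (p + m * p).
    by rewrite sumr_const -mulr_natl /m; ring.
  apply: ler_sum => v _; rewrite mulr_suml (bigD1 v)//= lerD//.
    rewrite -(Ap v) uniform_probE.
    by under eq_bigr do rewrite andbb.
  have -> : m * p = \sum_(w : V) p ^+ 2.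
    by rewrite sumr_const -mulr_natl /m; ring.
  rewrite [leRHS](bigD1 v)//= -[leLHS]add0r lerD ?sqr_ge0//.
  by apply: ler_sum => w wv; rewrite -uniform_probE AAp// eq_sym.
(* Where no [A v] occurs, [X x = 0], so the squared deviation is exactly [m ^+ 2]. *)
have Cheb : m ^+ 2 * uniform_prob R (fun x => [forall v, ~~ A v x]) <=
    (\sum_x (X x - m) ^+ 2) / M.
  rewrite uniform_probE mulrA ler_wpM2r ?invr_ge0 ?(ltW M0)// mulr_sumr.
  apply: ler_sum => x _; case: forallP => [Ax|_]; last first.
    by rewrite mulr0 sqr_ge0.
  by rewrite mulr1 /X big1 ?sub0r ?sqrrN// => v _; rewrite (negbTE (Ax v)).
have Var : (\sum_x (X x - m) ^+ 2) / M =
    (\sum_x X x ^+ 2) / M - m *+ 2 * ((\sum_x X x) / M) + m ^+ 2.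
  have -> : m ^+ 2 = (\sum_(x : T) m ^+ 2) / M.
    by rewrite sumr_const -mulr_natr mulfK// gt_eqF.
  rewrite mulrA -mulrBl -mulrDl; congr (_ / _).
  rewrite mulr_sumr -sumrB -big_split/=; apply: eq_bigr => x _; ring.
rewrite -(ler_pM2l (exprn_gt0 2 m0)) (le_trans Cheb)//.
rewrite Var EX expr2 mulfK ?gt_eqF// mulr2n; move: EX2; lra.
Qed.

(** * Below the threshold: vertices without incoming arcs *)

Lemma uniform_prob_no_arc_into (R : realType) (n k : nat) (S : {set 'I_n}) :
  uniform_prob R (fun D : kout_digraph n k => [forall a, D a \notin S]) =
  ((n - #|S|)%:R / n%:R) ^+ (n * k).
Proof.
transitivity (\prod_(a : 'I_n * 'I_k) (#|~: S|%:R / #|'I_n|%:R : R)).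
  rewrite -uniform_prob_prod; apply: eq_uniform_prob => D.
  by apply: eq_forallb => a; rewrite inE.
by rewrite prodr_const card_prod cardsCs finset.setCK !card_ord.
Qed.

(** A path to [v] from another vertex is nonempty and its last arc enters [v]; [1 < n] supplies the
    other vertex. *)
Lemma strongly_connected_in_arc (n k : nat) (D : kout_digraph n k)
    (v : 'I_n) :
  (1 < n)%N -> strongly_connected D -> [exists a, D a == v].
Proof.
move=> n1 SC.
have [u uv] : exists u : 'I_n, u != v.
  have /card_gt0P[u] : (0 < #|[set~ v]%SET|)%N.
    by rewrite cardsC1 card_ord -ltnS prednK// ltnW.
  by rewrite !inE => uv; exists u.
have /connectP[s] := forallP (forallP SC u) v.
elim/last_ind: s => [_ vu|s w _ + ->]; first by rewrite vu eqxx in uv.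
rewrite last_rcons rcons_path => /andP[_ /existsP[i Di]].
by apply/existsP; exists (last u s, i).
Qed.

Lemma strongly_connected_prob_le (R : realType) (n k : nat) :
  uniform_prob R (fun D : kout_digraph n k => strongly_connected D) <=
  expR (1 + (k%:R - ln (n%:R : R))).
Proof.
(* If [k - ln n >= -1] the bound is at least 1. Otherwise [k < ln n - 1], which forces [1 < n] and,
   at the end, [k <= n - 1]. *)
have [k_ge|k_lt] := lerP (-1) (k%:R - ln (n%:R : R)).
  by rewrite (le_trans (uniform_prob_le1 _ _))// -[leLHS]expR0 ler_expR; lra.
have n1 : (1 < n)%N.
  rewrite ltnNge; apply/negP => n_le1.
  have : ln (n%:R : R) <= 0 by rewrite ln_le0// lern1.
  by have := ler0n R k; lra.
have n0 : (0 < n)%N by exact: ltnW.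
have n1R : (1 : R) < n%:R by rewrite ltr1n.
set x : R := (n.-1)%:R / n%:R.
have nB : (n.-1)%:R = n%:R - 1 :> R by rewrite -subn1 natrB.
have x0 : 0 < x by rewrite divr_gt0// ?nB; lra.
pose A (v : 'I_n) : pred (kout_digraph n k) :=
  fun D => [forall a, D a \notin [set v]%SET].
have T0 : (0 < #|kout_digraph n k|)%N by rewrite card_ffun card_ord expn_gt0 n0.
have PA v : uniform_prob R (A v) = x ^+ (n * k).
  by rewrite uniform_prob_no_arc_into cards1 subn1.
have PAA v w : v != w ->
    uniform_prob R (fun D => A v D && A w D) <= (x ^+ (n * k)) ^+ 2.
  move=> vw.
  have -> : uniform_prob R (fun D => A v D && A w D) =
      uniform_prob R (fun D : kout_digraph n k =>
        [forall a, D a \notin [set v; w]%SET]).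
    apply: eq_uniform_prob => D; apply/andP/forallP => [[Av Aw] a|Avw].
      have := forallP Av a; have := forallP Aw a.
      by rewrite !inE => /negbTE -> /negbTE ->.
    by split; apply/forallP => a; have := Avw a; rewrite !inE negb_or => /andP[].
  rewrite uniform_prob_no_arc_into cards2 vw [leRHS]exprAC.
  rewrite lerXn2r ?nnegrE ?divr_ge0 ?exprn_ge0 ?(ltW x0)// natrB//.
  (* Negative correlation, arc by arc: [1 - 2/n <= (1 - 1/n)^2], with difference [1/n^2]. *)
  rewrite -subr_ge0 /x nB.
  have -> : ((n%:R - 1) / n%:R) ^+ 2 - (n%:R - 2) / n%:R = n%:R ^- 2 :> R.
    by field; lra.
  by rewrite invr_ge0 exprn_ge0.
have V0 : (0 < #|'I_n|)%N by rewrite card_ord.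
have := second_moment_method T0 V0 (exprn_gt0 (n * k) x0) PA PAA.
rewrite card_ord => noA_le; apply: le_trans (le_trans noA_le _).
  apply: le_uniform_prob => D SC; apply/forallP => v; apply/negP => Av.
  have /existsP[a] := strongly_connected_in_arc v n1 SC.
  by move: (forallP Av a); rewrite inE => /negbTE ->.
rewrite addrA expRB lnK ?posrE; last by lra.
rewrite invfM mulrC ler_pM2r ?invr_gt0; last by lra.
(* Now [x^-1 <= exp (1/(n-1))], so [x^-(nk) <= exp (k + k/(n-1))], and [k/(n-1) <= 1]. *)
have x1 : x^-1 = 1 + (n%:R - 1)^-1 by rewrite /x nB; field; lra.
rewrite -exprVn x1 (@le_trans _ _ (expR (n%:R - 1)^-1 ^+ (n * k)))//.
  rewrite lerXn2r ?nnegrE ?expR_ge0 ?expR_ge1Dx//.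
  by rewrite -x1 invr_ge0 ltW.
rewrite -expRM_natl ler_expR natrM.
have -> : n%:R * k%:R / (n%:R - 1) = k%:R + k%:R / (n%:R - 1) :> R.
  by field; lra.
rewrite [leRHS]addrC lerD2l ler_pdivrMr ?mul1r; last by lra.
have : ln (1 + (n%:R - 1) : R) <= n%:R - 1 by rewrite le_ln1Dx//; lra.
rewrite addrC subrK; lra.
Qed.

(** * Above the threshold: vertex sets that no arc leaves, and the union bound *)

Lemma not_strongly_connected_closed (n k : nat) (D : kout_digraph n k) :
  ~~ strongly_connected D ->
  exists2 S : {set 'I_n}, (0 < #|S| < n)%N &
    [forall a : 'I_n * 'I_k, (a.1 \in S) ==> (D a \in S)].
Proof.
rewrite negb_forall => /existsP[u]; rewrite negb_forall => /existsP[v uv].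
(* The vertices reachable from [u]: this set contains [u] and misses [v]. *)
exists [set w | connect (Defs.arc D) u w]%SET; last first.
  apply/forallP => -[w i]/=; apply/implyP; rewrite !inE => uw.
  apply: connect_trans uw (connect1 _).
  by apply/existsP; exists i.
apply/andP; split; first by apply/card_gt0P; exists u; rewrite inE connect0.
rewrite -[ltnRHS]card_ord -cardsT proper_card// finset.properT.
by apply/negP => /eqP/setP/(_ v); rewrite !inE (negbTE uv).
Qed.

Lemma uniform_prob_closed (R : realType) (n k : nat) (S : {set 'I_n}) :
  (0 < n)%N ->
  uniform_prob R (fun D : kout_digraph n k =>
    [forall a : 'I_n * 'I_k, (a.1 \in S) ==> (D a \in S)]) =
  (#|S|%:R / n%:R) ^+ (k * #|S|).
Proof.
move=> n0.
(* Arcs starting outside [S] are unconstrained and contribute a factor [n/n = 1]. *)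
pose F (a : 'I_n * 'I_k) := if a.1 \in S then S else [set: 'I_n]%SET.
transitivity (\prod_a (#|F a|%:R / #|'I_n|%:R : R)).
  rewrite -uniform_prob_prod; apply: eq_uniform_prob => D.
  by apply: eq_forallb => a; rewrite /F; case: ifP; rewrite ?inE.
pose x u : R := if u \in S then #|S|%:R / n%:R else 1.
rewrite exprM -prodr_const [RHS]big_mkcond/=.
transitivity (\prod_u \prod_(i < k) x u).
  rewrite pair_bigA; apply: eq_bigr => -[u i] _; rewrite /F /x /= card_ord.
  by case: ifP => // _; rewrite cardsT card_ord divff// pnatr_eq0 -lt0n.
apply: eq_bigr => u _; rewrite prodr_const card_ord /x.
by case: ifP => // _; rewrite expr1n.
Qed.

(* [C(n,s) x^s] is a term of [(1 + x)^n <= e^(nx)]; take [x = s/n]. *)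
Lemma binomial_entropy_le (R : realType) (n s : nat) :
  (0 < n)%N -> (s <= n)%N ->
  'C(n, s)%:R * (s%:R / n%:R) ^+ s <= expR (1 : R) ^+ s.
Proof.
move=> n0 sn; have n0R : (n%:R : R) != 0 by rewrite pnatr_eq0 -lt0n.
have x0 : 0 <= s%:R / n%:R :> R by rewrite divr_ge0.
apply: (@le_trans _ _ ((1 + s%:R / n%:R) ^+ n)).
  rewrite exprDn (bigD1 (Ordinal (sn : s < n.+1)%N))//= expr1n mul1r.
  rewrite mulr_natl lerDl sumr_ge0// => i _.
  by rewrite mulrn_wge0// mulr_ge0// exprn_ge0.
rewrite -expRM_natl mulr1; set x := s%:R / n%:R.
have -> : s%:R = n%:R * x :> R by rewrite /x; field.
by rewrite expRM_natl lerXn2r ?nnegrE ?expR_ge0 ?addr_ge0 ?expR_ge1Dx.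
Qed.

(** One of the [k] factors [(s/n)^s] absorbs the binomial coefficient at cost [e^s]. In the other
    [k - 1], [s/n <= exp (s/n - 1) <= exp (-1/2)]. The exponent per vertex is thus [1 - (k-1)/2]. *)
Lemma binomial_closed_small_le (R : realType) (n k s : nat) :
  (0 < k)%N -> (0 < s)%N -> (s.*2 <= n)%N ->
  'C(n, s)%:R * (s%:R / n%:R) ^+ (k * s) <=
  expR (2 - (k%:R - ln (n%:R : R)) / 2) ^+ s.
Proof.
move=> k0 s0 sn.
have n0 : (0 < n)%N by move: sn; rewrite -addnn; lia.
have n0R : 0 < n%:R :> R by rewrite ltr0n.
have le_sn : (s <= n)%N by move: sn; rewrite -addnn; lia.
set x : R := s%:R / n%:R.
have x0 : 0 <= x by rewrite divr_ge0.
have x_half : x <= 2^-1.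
  rewrite /x ler_pdivrMr// mulrC ler_pdivlMr// -natrM ler_nat.
  by rewrite muln2.
have x_exp : x <= expR (- 2^-1).
  have := expR_ge1Dx (x - 1); rewrite addrC subrK => /le_trans; apply.
  by rewrite ler_expR; lra.
have -> : (k * s = s + k.-1 * s)%N by rewrite -[in LHS](prednK k0) mulSn.
rewrite exprD mulrA exprM.
apply: (@le_trans _ _ (expR 1 ^+ s * (expR (- 2^-1) ^+ k.-1) ^+ s)).
  rewrite ler_pM ?mulr_ge0 ?exprn_ge0//; first exact: binomial_entropy_le.
  by rewrite !lerXn2r ?nnegrE ?exprn_ge0 ?expR_ge0.
rewrite -exprMn lerXn2r ?nnegrE ?mulr_ge0 ?exprn_ge0 ?expR_ge0//.
rewrite -expRM_natl -expRD ler_expR -subn1 natrB//.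
have : 0 <= ln (n%:R : R) by rewrite ln_ge0// ler1n.
lra.
Qed.

(** Here [t] is the size of the complement of the closed set. With [y = t/n], the coefficient is at
    most [(e/y)^t] and the probability at most [exp (-k(1-y))^t]; the factor [1/y] may be as large
    as [n], which is where [ln n] is needed. *)
Lemma binomial_closed_large_le (R : realType) (n k t : nat) :
  (0 < t)%N -> (t.*2 <= n)%N -> ln (n%:R : R) <= k%:R ->
  'C(n, t)%:R * ((n - t)%:R / n%:R) ^+ (k * (n - t)) <=
  expR (2 - (k%:R - ln (n%:R : R)) / 2) ^+ t.
Proof.
move=> t0 tn kn.
have n0 : (0 < n)%N by move: tn; rewrite -addnn; lia.
have le_tn : (t <= n)%N by move: tn; rewrite -addnn; lia.
have n0R : 0 < n%:R :> R by rewrite ltr0n.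
have t0R : 0 < t%:R :> R by rewrite ltr0n.
set y : R := t%:R / n%:R.
have y0 : 0 < y by rewrite divr_gt0.
have y_half : y <= 2^-1.
  by rewrite /y ler_pdivrMr// mulrC ler_pdivlMr// -natrM ler_nat muln2.
have lny : ln y = ln (t%:R : R) - ln (n%:R : R) by rewrite ln_div.
have y_ln : y * ln (n%:R : R) <= 1 + ln (t%:R : R).
  (* [y ln n = y ln t + y ln (1/y)] *)
  have : y * (- ln y) <= 1.
    have : ln y^-1 < y^-1 by rewrite ln_sublinear// invr_gt0.
    by rewrite lnV ?posrE// mulrC -ler_pdivlMr// div1r => /ltW.
  have : 0 <= (1 - y) * ln (t%:R : R).
    by rewrite mulr_ge0 ?ln_ge0 ?ler1n//; lra.
  rewrite lny; lra.
have C_le : 'C(n, t)%:R <= expR (1 - ln y) ^+ t.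
  rewrite expRB expr_div_n lnK ?posrE// ler_pdivlMr ?exprn_gt0//.
  exact: binomial_entropy_le.
have closed_le : ((n - t)%:R / n%:R) ^+ (k * (n - t)) <=
    expR (- (k%:R * (1 - y))) ^+ t.
  have -> : (n - t)%:R / n%:R = 1 - y.
    by rewrite natrB// /y; field; rewrite gt_eqF.
  apply: (@le_trans _ _ (expR (- y) ^+ (k * (n - t)))).
    by rewrite lerXn2r ?nnegrE ?expR_ge0 ?expR_ge1Dx//; lra.
  rewrite -!expRM_natl ler_expR natrM natrB//.
  have -> : n%:R = t%:R / y by rewrite /y; field; rewrite !gt_eqF.
  rewrite le_eqVlt; apply/orP; left; apply/eqP; field; rewrite gt_eqF//.
apply: (le_trans (ler_pM _ _ C_le closed_le)); rewrite ?exprn_ge0 ?divr_ge0//.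
rewrite -exprMn lerXn2r ?nnegrE ?mulr_ge0 ?expR_ge0// -expRD ler_expR.
(* The exponent is [1 - ln t + y ln n - (k - ln n)(1 - y)]. By [y_ln] the first three terms are at
   most 2, and [1 - y >= 1/2]. *)
have : 0 <= (k%:R - ln (n%:R : R)) * (2^-1 - y) by rewrite mulr_ge0//; lra.
rewrite lny; lra.
Qed.

Lemma sum_geometric_le (R : realType) (q : R) (n : nat) :
  0 <= q <= 2^-1 -> \sum_(1 <= s < n) q ^+ s <= 2 * q.
Proof.
move=> /andP[q0 q_half].
(* The left side starts at 2 and does not increase with [m], since [q <= 1/2] gives
   [q^m + 2 q^(m+1) <= 2 q^m]. *)
have sum_le m : \sum_(0 <= s < m) q ^+ s + 2 * q ^+ m <= 2.
  elim: m => [|m IH]; first by rewrite big_nil expr0; lra.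
  apply: le_trans IH; rewrite big_nat_recr//= exprS.
  have : 0 <= q ^+ m * (2^-1 - q) by rewrite mulr_ge0 ?exprn_ge0//; lra.
  lra.
case: n => [|n]; first by rewrite big_geq// mulr_ge0.
rewrite big_add1/=; under eq_bigr do rewrite exprS.
rewrite -mulr_sumr mulrC ler_wpM2r//.
have := sum_le n; have := exprn_ge0 n q0; lra.
Qed.

Lemma not_strongly_connected_prob_le (R : realType) (n k : nat) :
  (0 < n)%N ->
  uniform_prob R (fun D : kout_digraph n k => ~~ strongly_connected D) <=
  4 * expR (2 - (k%:R - ln (n%:R : R)) / 2).
Proof.
move=> n0; set q := expR _.
have q0 : 0 <= q by exact: expR_ge0.
(* For [q > 1/2] the bound exceeds 1. Otherwise [q < 1], that is, [k - ln n > 4], so the bound for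
   large sets applies. *)
have [q_half|q_half] := lerP q 2^-1; last first.
  by rewrite (le_trans (uniform_prob_le1 _ _))//; lra.
have : q < 1 by lra.
rewrite expR_lt1 => kn_gt4.
have lnn : 0 <= ln (n%:R : R) by rewrite ln_ge0// ler1n.
have k0 : (0 < k)%N by rewrite -(ltr0n R); lra.
apply: le_trans (@uniform_prob_union R _ _ _ _ _
  (@not_strongly_connected_closed n k)) _.
under eq_bigr do rewrite uniform_prob_closed//.
pose P s : R := (s%:R / n%:R) ^+ (k * s).
(* Group the sets by size. Sizes are at most [n], so [inord] into ['I_n.+1] loses nothing. *)
have -> : \sum_(S : {set 'I_n} | (0 < #|S| < n)%N) P #|S| =
    \sum_(1 <= s < n) 'C(n, s)%:R * P s.
  rewrite (partition_big (fun S : {set 'I_n} => inord #|S| : 'I_n.+1)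
    (fun s : 'I_n.+1 => 0 < s < n)%N)/=; last first.
    by move=> S; rewrite inordK// -[X in (_ < X.+1)%N]card_ord ltnS max_card.
  rewrite [RHS](big_nat_widen _ _ n.+1)// [RHS]big_geq_mkord.
  apply: eq_big => [s|s /andP[s0 sn]]; first by rewrite andbC.
  transitivity (\sum_(S in [set S : {set 'I_n} | #|S| == s]%SET) P s).
    apply: eq_big => [S|S /andP[_ /eqP <-]].
      rewrite inE -val_eqE/= inordK; last first.
        by rewrite -[X in (_ < X.+1)%N]card_ord ltnS max_card.
      by have [->|] := eqVneq #|S| s; rewrite ?s0 ?sn ?andbF.
    by rewrite inordK// -[X in (_ < X.+1)%N]card_ord ltnS max_card.
  by rewrite sumr_const card_draws card_ord mulr_natl.
(* Bounding [q^min(s, n-s)] by the sum of both powers avoids splitting the range; after reversal the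
   two sums agree, each at most [2q]. *)
apply: (@le_trans _ _ (\sum_(1 <= s < n) (q ^+ s + q ^+ (n - s)))).
  rewrite !big_nat; apply: ler_sum => s /andP[s0 sn].
  have [s_small|s_large] := leqP s.*2 n.
    rewrite (le_trans (binomial_closed_small_le _ _ _ _))// lerDl exprn_ge0//.
  have := @binomial_closed_large_le R n k (n - s).
  rewrite subKn ?(ltnW sn)// bin_sub ?(ltnW sn)// => /(_ _ _ _)/le_trans -> //.
  - by rewrite subn_gt0.
  - by move: s_large; rewrite -!addnn; lia.
  - lra.
  - by rewrite lerDr exprn_ge0.
rewrite big_split/= [X in _ + X]big_nat_rev/=.
under [X in _ + X]eq_big_nat => s /andP[s1 sn].
  rewrite (_ : n - (1 + n - s.+1) = s)%N; last by lia.
  over.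
have := @sum_geometric_le R q n; rewrite q0 q_half => /(_ isT); lra.
Qed.

(** * Passage to the limit on both sides of the threshold *)

Theorem theorem6 (R : realType) (k : nat -> nat)
    (k_gt0 : forall n : nat, (0 < n)%N -> (0 < k n)%N)
    (k_oo : k n @[n --> \oo] --> \oo) :
  ((k n)%:R - ln (n%:R : R) @[n --> \oo] --> -oo ->
     whp R (fun n (D : kout_digraph n (k n)) => ~~ strongly_connected D)) /\
  ((k n)%:R - ln (n%:R : R) @[n --> \oo] --> +oo ->
     whp R (fun n (D : kout_digraph n (k n)) => strongly_connected D)).
Proof.
have card_gt0 n : (0 < n)%N -> (0 < #|kout_digraph n (k n)|)%N.
  by move=> n0; rewrite card_ffun card_ord expn_gt0 n0.
have exp_cvg (u : nat -> R) : u n @[n --> \oo] --> +oo ->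
    expR (- u n) @[n --> \oo] --> 0.
  by move=> u_oo; exact: (cvg_comp _ _ u_oo (@cvgr_expR R)).
split=> kn; rewrite /whp.
  apply: (@squeeze_cvgr _ _ _ _
    (fun n => 1 - expR 1 * expR (- (ln (n%:R : R) - (k n)%:R))) (cst 1)).
  - near=> n; have n0 : (0 < n)%N by near: n; exact: nbhs_infty_ge.
    rewrite uniform_prob_le1 andbT uniform_probC ?card_gt0// lerB//.
    by rewrite opprB -expRD strongly_connected_prob_le.
  - rewrite -[X in _ --> X]subr0 -[X in _ --> _ - X](mulr0 (expR 1)).
    apply: cvgB; first exact: cvg_cst.
    apply: cvgM; first exact: cvg_cst.
    apply: exp_cvg; apply/cvgNrNy; apply: cvg_trans kn.
    by apply: near_eq_cvg; near=> n; rewrite opprB.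
  - exact: cvg_cst.
apply: (@squeeze_cvgr _ _ _ _ (fun n => 1 - 4 * expR 2 *
  expR (- (((k n)%:R - ln (n%:R : R)) / 2))) (cst 1)).
- near=> n; have n0 : (0 < n)%N by near: n; exact: nbhs_infty_ge.
  rewrite uniform_prob_le1 andbT -mulrA -expRD.
  have := @not_strongly_connected_prob_le R n (k n) n0.
  rewrite uniform_probC ?card_gt0//; lra.
- rewrite -[X in _ --> X]subr0 -[X in _ --> _ - X](mulr0 (4 * expR 2)).
  apply: cvgB; first exact: cvg_cst.
  apply: cvgM; first exact: cvg_cst.
  apply: exp_cvg; apply/cvgryPge => A.
  move/cvgryPge: kn => /(_ (2 * A)); apply: filterS => n; lra.
- exact: cvg_cst.
Unshelve. all: by end_near.
Qed.
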